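(* Let $\mathcal{G}(\pi)$ be a colored directed graph and let $V_L$ be a leader set. Let $\mathcal{G}'(\pi')$ be a colored graph obtained from $\mathcal{G}(\pi)$ by applying finitely many elementary edge operations with respect to the coloring set $V_L$. Then $(\mathcal{G}(\pi);V_L)$ is controllable if $V_L$ is a zero forcing set for $\mathcal{G}'(\pi')$.
   Context: Directed graphs $\mathcal{G}=(V,E)$ are simple: $V=\{1,\dots,n\}$, $E\subseteq V\times V$, and $E$ contains no edge $(i,i)$. A colored directed graph $\mathcal{G}(\pi)=(V,E,\pi)$ is a directed graph with a partition $\pi=\{E_1,\dots,E_k\}$ of $E$; edges in $E_r$ are said to have color $c_r$, and $\{c_1,\dots,c_k\}$ is the color set. Controllability. The qualitative class is $\mathcal{Q}(\mathcal{G})=\{A\in\mathbb{R}^{n\times n}\mid \text{for } i\neq j:\ A_{ij}\neq 0 \text{ iff } (j,i)\in E\}$ (diagonal entries are arbitrary reals), and the colored qualitative class is $\mathcal{Q}_\pi(\mathcal{G})=\{A\in\mathcal{Q}(\mathcal{G})\mid A_{ij}=A_{kl}\text{ if }(j,i),(l,k)\in E_r\text{ for some }r\}$. For a leader set $V_L=\{v_1,\dots,v_m\}\subseteq V$, let $B=B(V;V_L)\in\mathbb{R}^{n\times m}$ with $B_{ij}=1$ if $i=v_j$ and $B_{ij}=0$ otherwise. $(\mathcal{G}(\pi);V_L)$ is called controllable if the pair $(A,B)$ is controllable (in the classical sense for $\dot x=Ax+Bu$) for all $A\in\mathcal{Q}_\pi(\mathcal{G})$. Associated colored bipartite graphs.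 For disjoint $X=\{x_1,\dots,x_s\}$, $Y=\{y_1,\dots,y_t\}\subseteq V$, the associated colored bipartite graph has edge set $E_{XY}=\{\{x_i,y_j\}\mid (x_i,y_j)\in E\}$, where $\{x_i,y_j\}$ inherits the color of $(x_i,y_j)$. If $s=t$, a perfect matching is a set of edges $\{\{x_1,y_{\gamma(1)}\},\dots,\{x_t,y_{\gamma(t)}\}\}\subseteq E_{XY}$ with $\gamma$ a permutation of $(1,\dots,t)$; its sign is the sign of $\gamma$; its spectrum is the multiset of colors of its edges. Two perfect matchings are equivalent if they have the same spectrum, and the signature of an equivalence class is the sum of the signs of the perfect matchings in it. Color change rule and zero forcing. A coloring set $C\subseteq V$ is the set of vertices initially colored black; all others are white. For $X\subseteq C$, $N_{V\setminus C}(X)=\{j\in V\setminus C\mid \exists\, i\in X:\ (i,j)\in E\}$. For $X\subseteq C$ and $Y\subseteq V$ with $|X|=|Y|$, $Y$ is a color-perfect white neighbor of $X$ if (1) $Y=N_{V\setminus C}(X)$, and (2) in the colored bipartite graph associated with $X,Y$ there exists a perfect matching and exactly one equivalence class of perfect matchings has nonzero signature. Color change rule: if $C$ is the current set of black vertices, $X\subseteq C$, and $Y$ is a color-perfect white neighbor of $X$, then color all vertices in $Y$ black; write $X\xrightarrow{c}Y$. A derived set $\mathcal{D}_c(C)$ is a set of black vertices obtained from $C$ by repeated application of the color change rule until no more changes are possible (it need not be unique). $C$ is a zero forcing set for $\mathcal{G}(\pi)$ if there exists a derived set $\mathcal{D}_c(C)$ with $\mathcal{D}_c(C)=V$. Elementary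 edge operations. Let $C\subseteq V$ be a coloring set. For $u\in C$ let $N_{V\setminus C}(u)=\{j\in V\setminus C\mid (u,j)\in E\}$, and for $u,v\in C$ (possibly equal) let $\mathcal{E}_u(v)=\{(v,j)\in E\mid j\in N_{V\setminus C}(u)\}$. The two elementary edge operations (with respect to $C$) are: (1) Turn color: for $u\in C$ such that all edges in $\mathcal{E}_u(u)$ have the same color, change the color of these edges to any other color in the color set. (2) Remove edges: for distinct $u,v\in C$ such that $N_{V\setminus C}(u)\subseteq N_{V\setminus C}(v)$ and such that for every $k\in N_{V\setminus C}(u)$ the edges $(u,k)$ and $(v,k)$ have the same color, remove all edges in $\mathcal{E}_u(v)$. The operations may be applied sequentially, each one to the colored graph resulting from the previous one. *)

(* Defs.v *)
From Stdlib Require Import Relation_Operators.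
From HB Require Import structures.
From mathcomp Require Import all_boot all_order all_algebra all_fingroup.
From mathcomp Require Import reals topology normedtype derive.
From mathcomp Require Import finset.

Set Implicit Arguments.
Unset Strict Implicit.
Unset Printing Implicit Defensive.

Import Order.TTheory GRing.Theory Num.Theory.
Import numFieldNormedType.Exports.

Local Open Scope ring_scope.

(** The vertex set {1, ..., n} is ['I_n] and the color set {c_1, ..., c_k} is
    ['I_k].  A colored graph is given by its color cells E_1, ..., E_k, the
    edge set being their disjoint union.  A cell may be empty: recoloring or
    removing edges can exhaust a color, which nevertheless stays in the color
    set. *)
Record colored_digraph (n k : nat) := ColoredDigraph {
  cell : 'I_k -> {set 'I_n * 'I_n};
  cell_disjoint : forall r s : 'I_k, r != s -> [disjoint cell r & cell s];
  cell_loopless : forall (r : 'I_k) (i : 'I_n), (i, i) \notin cell r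
}.

Section ColoredGraphs.
Variables n k : nat.
Implicit Types (G : colored_digraph n k) (C D X Y : {set 'I_n}).

Definition edges G : {set 'I_n * 'I_n} := \bigcup_(r < k) cell G r.

Definition same_color G (e f : 'I_n * 'I_n) : bool :=
  [exists r : 'I_k, (e \in cell G r) && (f \in cell G r)].

(** N_{V \ C}(X) *)
Definition white_nbrs G C X : {set 'I_n} :=
  [set j | (j \notin C) && [exists i in X, (i, j) \in edges G]].

Section Matchings.
Variables (G : colored_digraph n k) (t : nat) (x y : 'I_t -> 'I_n).

(** The perfect matching {x_i, y_(g i)}, i = 1..t, is represented by g. *)
Definition perfect_matchings : {set 'S_t} :=
  [set g : 'S_t | [forall i, (x i, y (g i)) \in edges G]].

(** Multiset of edge colors, as a multiplicity function. *)
Definition spectrum (g : 'S_t) : {ffun 'I_k -> nat} :=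
  [ffun r => #|[set i | (x i, y (g i)) \in cell G r]|].

Definition matching_classes : {set {set 'S_t}} :=
  preim_partition spectrum perfect_matchings.

Definition signature (S : {set 'S_t}) : int :=
  \sum_(g in S) (-1) ^+ odd_perm g.

End Matchings.

(** The sets X and Y are enumerated injectively as x_1, ..., x_t and
    y_1, ..., y_t, which encodes |X| = |Y|; another choice of enumerations
    changes all signatures by a common sign. *)
Definition color_perfect_white_nbr G C X Y : Prop :=
  exists (t : nat) (x y : 'I_t -> 'I_n),
    [/\ [/\ injective x, injective y, X = [set x i | i : 'I_t]
          & Y = [set y i | i : 'I_t]],
        Y = white_nbrs G C X,
        exists g : 'S_t, g \in perfect_matchings G x y
      & #|[set S in matching_classes G x y | signature S != 0]| = 1%N].

Definition color_change G C C' : Prop :=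
  exists X Y, [/\ X \subset C, color_perfect_white_nbr G C X Y & C' = C :|: Y].

Definition derived_set G C D : Prop :=
  clos_refl_trans _ (color_change G) C D /\
  (forall D', color_change G D D' -> D' = D).

Definition zero_forcing_set G C : Prop :=
  exists D, derived_set G C D /\ D = [set: 'I_n].

(** The edge set written E_u(v), relative to the coloring set C. *)
Definition op_edges G C (u v : 'I_n) : {set 'I_n * 'I_n} :=
  [set e in edges G | (e.1 == v) && (e.2 \in white_nbrs G C [set u])].

Definition turn_color C G G' : Prop :=
  exists (u : 'I_n) (r c : 'I_k),
    [/\ u \in C, op_edges G C u u \subset cell G r, c != r
      & forall s, cell G' s = if s == c then cell G s :|: op_edges G C u u
                              else cell G s :\: op_edges G C u u].

Definition remove_edges C G G' : Prop :=
  exists u v : 'I_n,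
    [/\ [/\ u \in C, v \in C & u != v],
        white_nbrs G C [set u] \subset white_nbrs G C [set v],
        forall j, j \in white_nbrs G C [set u] -> same_color G (u, j) (v, j)
      & forall s, cell G' s = cell G s :\: op_edges G C u v].

Definition elementary_edge_operation C G G' : Prop :=
  turn_color C G G' \/ remove_edges C G G'.

End ColoredGraphs.

Section Controllability.
Variable R : realType.

(** x' = A x + B u can be steered from any state to any other in finite time.
    Trajectories are taken on the whole line: a continuous input on [0, T]
    extends continuously, and then so does the corresponding solution. *)
Definition controllable_pair (n m : nat) (A : 'M[R]_n) (B : 'M[R]_(n, m)) :
    Prop :=
  forall x0 x1 : 'cV[R]_n,
  exists (T : R) (u : R -> 'cV[R]_m) (x : R -> 'cV[R]_n),
    [/\ 0 < T,
        forall j, continuous (fun t : R => u t j ord0),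
        forall (t : R) (i : 'I_n),
          is_derive t 1 (fun s : R => x s i ord0)
            ((A *m x t + B *m u t) i ord0)
      & x 0 = x0 /\ x T = x1].

Definition qualitative_class (n k : nat) (G : colored_digraph n k)
    (A : 'M[R]_n) : Prop :=
  forall i j, i != j -> (A i j != 0) = ((j, i) \in edges G).

Definition colored_qualitative_class (n k : nat) (G : colored_digraph n k)
    (A : 'M[R]_n) : Prop :=
  qualitative_class G A /\
  forall (r : 'I_k) (i j p l : 'I_n),
    (j, i) \in cell G r -> (l, p) \in cell G r -> A i j = A p l.

(** The leaders v_1, ..., v_m are [enum_val 0, ..., enum_val (m - 1)]. *)
Definition leader_mx (n : nat) (VL : {set 'I_n}) : 'M[R]_(n, #|VL|) :=
  \matrix_(i < n, j < #|VL|) (i == enum_val j)%:R.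

Definition controllable (n k : nat) (G : colored_digraph n k)
    (VL : {set 'I_n}) : Prop :=
  forall A : 'M[R]_n, colored_qualitative_class G A ->
    controllable_pair A (leader_mx VL).

End Controllability.

(* Main.v *)
Require Import Defs.
From Stdlib Require Import Relation_Operators.
From HB Require Import structures.
From mathcomp Require Import all_boot all_order all_algebra all_fingroup.
From mathcomp Require Import reals topology normedtype derive.
From mathcomp Require Import finset.
From mathcomp Require Import ring.

Set Implicit Arguments.
Unset Strict Implicit.
Unset Printing Implicit Defensive.

Import GRing.Theory Num.Theory.
Local Open Scope ring_scope.

(** Controllability of (A, B) follows from Kalman's condition: every linear set
    of states that is A-invariant and contains the columns of B is the whole
    state space.  For the leader matrix the columns are the basis vectors e_j of the
    leaders, so the proof has a combinatorial half, which establishes that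
    condition, and an analytic half, which steers the system.

    Combinatorial half.  Let W be linear, A-invariant, and contain e_j for
    every black vertex j.  If X forces Y, then for x in X the vector A e_x lies
    in W, and modulo the black basis vectors it equals the combination of the
    e_y, y in Y, with coefficients A_yx.  So W contains all e_y as soon as the
    square block A_YX is invertible ([color_change_closed]).  The Leibniz
    expansion of its determinant runs over perfect matchings; matchings with
    equal spectra contribute equal monomials in the nonzero color values, so
    the determinant is the sum over the classes of signature times monomial,
    and a single class of nonzero signature makes it nonzero
    ([det_matchings_neq0]).  Iterating, a zero forcing set generates the state
    space ([zero_forcing_generates]).

    An elementary edge operation replaces A by the matrix obtained from it by
    adding a multiple of column u to column v in the white rows only, u being
    black.  The change of column v then lies in the span of A e_u and the black
    basis vectors, hence in every W as above, and W is invariant under the new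
    matrix too ([generates_add_column]).  Hence generation by the leaders pulls
    back along edge operations from G' to G ([edge_operations_generates]).

    Analytic half.  Both states and inputs can be taken polynomial in time, on
    the interval from 0 to 1.  Put q = t (t - 1).  A Hensel-type iteration
    produces, for every N, a polynomial curve z with the prescribed end points
    such that q^N divides z' - A z ([approximate_trajectory]).  On the other
    hand, call a state vector a flatly correctable if for some N every forcing
    term q^N p a equals w' - A w - B u for some polynomial w vanishing at both
    end points and some polynomial input u.  Such vectors form a linear set
    that contains the columns of B, with w = 0, and that is A-invariant, since
    subtracting f a from w turns f' a into f A a.  By Kalman's condition every
    vector is flatly correctable, and adding a suitable w to z gives an exact
    trajectory ([polynomial_steering]). *)

(** * Invariant linear sets *)

Section LinearSets.
Variables (F : fieldType) (n : nat).
Implicit Types (W : 'cV[F]_n -> Prop) (A : 'M[F]_n) (C : {set 'I_n}).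

(** Subspaces are Prop-valued predicates, not row spaces or [{vspace _}], so
    that a property defined by existential quantification can be one. *)
Definition linear_set W :=
  W 0 /\ forall a u v, W u -> W v -> W (a *: u + v).

Lemma linear_set_sum W (I : finType) (P : pred I) (a : I -> F)
    (v : I -> 'cV[F]_n) :
  linear_set W -> (forall i, P i -> W (v i)) -> W (\sum_(i | P i) a i *: v i).
Proof.
by move=> [W0 WZD] Wv; apply: big_rec => // i w /Wv; apply: WZD.
Qed.

Lemma cV_sum_delta (v : 'cV[F]_n) : v = \sum_i v i 0 *: delta_mx i 0.
Proof.
by rewrite [LHS]matrix_sum_delta; apply: eq_bigr => i _; rewrite big_ord1.
Qed.

Lemma linear_set_support W C (v : 'cV[F]_n) : linear_set W ->
  (forall j, j \in C -> W (delta_mx j 0)) ->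
  (forall i, i \notin C -> v i 0 = 0) -> W v.
Proof.
move=> linW WC v0; rewrite [v]cV_sum_delta (bigID (mem C)) /=.
rewrite [X in _ + X]big1 => [|i /v0->]; last by rewrite scale0r.
by rewrite addr0; apply: linear_set_sum.
Qed.

Definition kalman_condition m A (B : 'M[F]_(n, m)) := forall W, linear_set W ->
  (forall v, W v -> W (A *m v)) -> (forall j, W (col j B)) ->
  forall v, W v.

Definition generates A C := forall W, linear_set W ->
  (forall v, W v -> W (A *m v)) -> (forall j, j \in C -> W (delta_mx j 0)) ->
  forall v, W v.

Definition add_column A C u v (a : F) : 'M[F]_n :=
  \matrix_(i, j) (A i j + ((j == v) && (i \notin C))%:R * (a * A i u)).

(** The added column is [a] times [A e_u] corrected by basis vectors of [C], so
    it lies in every A-invariant linear set that contains those basis vectors;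
    such a set is therefore invariant under the new matrix as well. *)
Lemma generates_add_column A C u v a : u \in C ->
  generates (add_column A C u v a) C -> generates A C.
Proof.
move=> uC gen W linW invW WC; apply: gen => // w Ww.
set d : 'cV[F]_n := \col_i ((i \notin C)%:R * (a * A i u)).
have -> : add_column A C u v a *m w = w v 0 *: d + A *m w.
  apply/matrixP => i j; rewrite !mxE addrC [j]ord1.
  under eq_bigr do rewrite mxE mulrDl.
  rewrite big_split /=; congr (_ + _); rewrite (bigD1 v) //= eqxx /= mulrC.
  rewrite big1 ?addr0 // => l /negPf->.
  by rewrite !mul0r.
have Wd : W d.
  have -> : d = a *: (A *m delta_mx u 0) + (d - a *: (A *m delta_mx u 0)).
    by rewrite addrC subrK.
  apply: linW.2; first exact/invW/WC.
  apply: linear_set_support WC _ => // i iC.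
  by rewrite -colE !mxE iC mul1r subrr.
by apply: linW.2 => //; apply: invW.
Qed.

End LinearSets.

(** * Color values and determinants of matchings *)

Section Realizations.
Variables (F : numFieldType) (n k : nat).
Implicit Types (G : colored_digraph n k) (c : 'I_k -> F) (A : 'M[F]_n).
Implicit Types (C D X Y : {set 'I_n}).

(** The colored qualitative class with the common value [c r] of each color
    made explicit.  A color with an empty cell has a value too: turning edges
    to that color needs one. *)
Definition realizes G c A :=
  [/\ forall r, c r != 0,
      forall r i j, (j, i) \in cell G r -> A i j = c r
    & forall i j, i != j -> (j, i) \notin edges G -> A i j = 0].

Lemma in_cell_eq G r s e : e \in cell G r -> (e \in cell G s) = (s == r).
Proof.
move=> er; apply/idP/eqP => [es|->//]; apply/eqP; apply: contraT => nsr.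
by have /disjointFr/(_ es) := cell_disjoint G nsr; rewrite er.
Qed.

Lemma edgesP G e : reflect (exists r, e \in cell G r) (e \in edges G).
Proof.
by apply: (iffP bigcupP) => [[r _ ?]|[r ?]]; exists r.
Qed.

Lemma in_white_nbrs1 G C u j :
  (j \in white_nbrs G C [set u]) = (j \notin C) && ((u, j) \in edges G).
Proof.
rewrite inE; congr (_ && _); apply/exists_inP/idP => [[i]|uj].
  by rewrite inE => /eqP->.
by exists u; rewrite ?inE.
Qed.

Section Matchings.
Variables (G : colored_digraph n k) (c : 'I_k -> F) (A : 'M[F]_n).
Variables (t : nat) (x y : 'I_t -> 'I_n).
Hypothesis realA : realizes G c A.
Hypothesis neq_xy : forall i j, x i != y j.

Let weight (g : 'S_t) := \prod_r c r ^+ spectrum G x y g r.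

Lemma prod_matching (g : 'S_t) : g \in perfect_matchings G x y ->
  \prod_i A (y (g i)) (x i) = weight g.
Proof.
case: realA => _ cA _; rewrite inE => /forallP gE.
rewrite /weight; under [RHS]eq_bigr => r _.
  rewrite ffunE -prodr_const; under eq_bigl do rewrite inE; over.
rewrite (exchange_big_dep predT) //=; apply: eq_bigr => i _.
have /edgesP[r ir] := gE i; rewrite (cA _ _ _ ir).
by rewrite (big_pred1 r) // => s; rewrite /= (in_cell_eq s ir).
Qed.

Lemma det_matchings :
  \det (\matrix_(i, j) A (y j) (x i)) =
  \sum_(g in perfect_matchings G x y) (-1) ^+ odd_perm g * weight g.
Proof.
rewrite /determinant (bigID (mem (perfect_matchings G x y))) /= addrC big1.
  rewrite add0r; apply: eq_bigr => g gP.
  by under eq_bigr do rewrite mxE; rewrite prod_matching.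
move=> g; rewrite inE negb_forall => /existsP[i niE].
rewrite (bigD1 i) //= mxE; case: realA => _ _ ->; rewrite ?mul0r ?mulr0 //.
by rewrite eq_sym.
Qed.

(** Matchings in one class carry the same monomial in the color values, so the
    class contributes its signature times that nonzero monomial, and only one
    class survives. *)
Lemma det_matchings_neq0 :
  #|[set S in matching_classes G x y | signature S != 0]| = 1%N ->
  \det (\matrix_(i, j) A (y j) (x i)) != 0.
Proof.
move=> /eqP/cards1P[S0 defS0].
rewrite det_matchings.
rewrite (set_partition_big _ (preim_partitionP (spectrum G x y) _)) /=.
have sumS S : S \in matching_classes G x y -> exists2 g0,
  \sum_(g in S) (-1) ^+ odd_perm g * weight g = (signature S)%:~R * weight g0
  & weight g0 != 0.
  case/imsetP=> g0 _ -> /=; exists g0; last first.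
    by apply/prodf_neq0 => r _; rewrite expf_neq0 //; case: realA.
  rewrite /signature rmorph_sum /= mulr_suml; apply: eq_bigr => g.
  rewrite inE => /andP[_ /eqP spec_g].
  by rewrite /weight -spec_g rmorphXn rmorphN1.
have : S0 \in [set S0] by rewrite inE.
rewrite -defS0 inE => /andP[S0P sgS0].
rewrite (bigD1 S0) //= [X in _ + X]big1 => [|S /andP[SP neqS]].
  case: (sumS S0 S0P) => g0 -> w0.
  by rewrite addr0 mulf_neq0 // intr_eq0.
case: (sumS S SP) => g0 -> _.
have : S \notin [set S0] by rewrite inE.
by rewrite -defS0 inE SP negbK => /eqP->; rewrite mul0r.
Qed.

End Matchings.

(** * Zero forcing *)

(** If [X] forces [Y], the vectors [A e_x] reduce, modulo the black basis
    vectors, to combinations of the [e_y] whose coefficient matrix is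
    invertible; inverting it expresses each [e_y] by members of [W]. *)
Lemma color_change_closed G c A D D' (W : 'cV[F]_n -> Prop) :
  realizes G c A -> linear_set W -> (forall v, W v -> W (A *m v)) ->
  color_change G D D' -> (forall j, j \in D -> W (delta_mx j 0)) ->
  forall j, j \in D' -> W (delta_mx j 0).
Proof.
move=> realA linW invW [X [Y [sXD]]].
move=> [t [x [y [[_ inj_y defX defY] YN _ sgn]]]] ->.
move=> WD j; rewrite inE => /orP[/WD//|].
have xD i : x i \in D by apply: (subsetP sXD); rewrite defX imset_f.
have yY l : y l \in Y by rewrite defY imset_f.
have nyD l : y l \notin D by have := yY l; rewrite YN inE => /andP[].
have neq_xy i l : x i != y l.
  by apply: contraNneq (nyD l) => <-; apply: xD.
set M := \matrix_(i, l) A (y l) (x i).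
have Mu : M \in unitmx.
  by rewrite unitmxE unitfE (det_matchings_neq0 realA).
have WM i : W (\sum_l M i l *: delta_mx (y l) 0).
  (* This sum differs from A e_(x i) by black basis vectors only: white
     out-neighbors of x i outside Y do not exist. *)
  set s := \sum_l _.
  have -> : s = 1 *: (A *m delta_mx (x i) 0) + (s - A *m delta_mx (x i) 0).
    by rewrite scale1r addrC subrK.
  apply: linW.2; first exact/invW/WD/xD.
  apply: linear_set_support WD _ => // p npD.
  rewrite -colE !mxE summxE; apply/eqP; rewrite subr_eq0; apply/eqP.
  have [|npY] := boolP (p \in Y).
    rewrite defY => /imsetP[l _ ->]; rewrite (bigD1 l) //= big1 => [|l' nl'].
      by rewrite !mxE !eqxx mulr1 addr0.
    by rewrite !mxE (inj_eq inj_y) eq_sym (negPf nl') mulr0.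
  rewrite big1 => [|l _]; last first.
    rewrite !mxE; case: eqP => [epl|]; last by rewrite mulr0.
    by rewrite epl yY in npY.
  case: realA => _ _ -> //; first by apply: contraNneq npD => ->.
  apply: contraNN npY => pE; rewrite YN inE npD; apply/exists_inP.
  by exists (x i); rewrite // defX imset_f.
rewrite defY => /imsetP[l _ ->].
have -> : delta_mx (y l) 0 =
    \sum_i invmx M l i *: \sum_l' M i l' *: delta_mx (y l') 0 :> 'cV[F]_n.
  transitivity (\sum_l' (invmx M *m M) l l' *: delta_mx (y l') 0 : 'cV[F]_n).
    rewrite mulVmx // (bigD1 l) //= big1 => [|l' nl'].
      by rewrite mxE eqxx scale1r addr0.
    by rewrite mxE eq_sym (negPf nl') scale0r.
  under eq_bigr do rewrite mxE scaler_suml.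
  rewrite exchange_big; apply: eq_bigr => i _; rewrite scaler_sumr.
  by apply: eq_bigr => l' _; rewrite scalerA.
exact: linear_set_sum.
Qed.

Lemma zero_forcing_generates G c A C :
  realizes G c A -> zero_forcing_set G C -> generates A C.
Proof.
move=> realA [D [[CD _] defD]] W linW invW WC v.
apply: (@linear_set_support _ _ _ setT) => // [|i]; last by rewrite inE.
rewrite -defD.
elim: CD WC => // {D defD C} [C D CD|C D E _ IH1 _ IH2] WC.
  exact: (color_change_closed realA linW invW CD WC).
by apply: IH2; apply: IH1.
Qed.

(** * Elementary edge operations *)

(** Recoloring the white edges of [u] from [r] to [s] scales column [u] by
    [c s / c r] in the white rows, that is, adds [c s / c r - 1] times it to
    itself. *)
Lemma turn_color_realizes C G G' c A : realizes G c A -> turn_color C G G' ->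
  exists u v a, u \in C /\ realizes G' c (add_column A C u v a).
Proof.
move=> [c0 cA A0] [u [r [s [uC opr nsr cellG']]]].
have opE i j : ((j, i) \in op_edges G C u u) =
    [&& (j, i) \in edges G, j == u & i \notin C].
  rewrite inE /= in_white_nbrs1; case: eqP => [->|]; last by rewrite !andbF.
  by rewrite /=; case: (_ \in edges G); rewrite ?andbT ?andbF.
exists u, u, (c s / c r - 1); split=> //; split=> // [p i j|i j nij].
  rewrite mxE cellG'; case: (boolP ((j, i) \in op_edges G C u u)) => [jiO|njiO].
    have jir := subsetP opr _ jiO; move: (jiO); rewrite opE => /and3P[_ ju ->].
    rewrite ju (cA _ _ _ jir).
    have -> : A i u = c r by rewrite -(eqP ju); apply: cA jir.
    case: (eqVneq p s) => [-> _|_].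
      by rewrite mul1r; field.
    by rewrite in_setD jiO.
  have -> : ((j, i) \in if p == s then cell G p :|: op_edges G C u u
                        else cell G p :\: op_edges G C u u)
            = ((j, i) \in cell G p).
    by case: ifP; rewrite inE (negPf njiO) ?orbF.
  move=> jip; rewrite (cA _ _ _ jip).
  suff -> : (j == u) && (i \notin C) = false by rewrite mul0r addr0.
  apply: contraNF njiO => jui; rewrite opE jui andbT.
  by apply/edgesP; exists p.
move=> njiE'; have njiO : (j, i) \notin op_edges G C u u.
  apply: contraNN njiE' => jiO; apply/edgesP; exists s.
  by rewrite cellG' eqxx inE jiO orbT.
have njiE : (j, i) \notin edges G.
  apply: contraNN njiE' => /edgesP[p jip]; apply/edgesP; exists p.
  by rewrite cellG'; case: ifP; rewrite inE jip // njiO.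
rewrite mxE A0 // add0r; case: eqP => [<-|]; last by rewrite mul0r.
by rewrite A0 // !mulr0.
Qed.

(** Subtracting column [u] from column [v] in the white rows cancels exactly
    the removed entries, because there the two columns carry the same color;
    the other white entries of column [u] are zero. *)
Lemma remove_edges_realizes C G G' c A : realizes G c A ->
  remove_edges C G G' ->
  exists u v a, u \in C /\ realizes G' c (add_column A C u v a).
Proof.
move=> [c0 cA A0] [u [v [[uC vC nuv] sN same cellG']]].
have opE i j : ((j, i) \in op_edges G C u v) =
    [&& (j, i) \in edges G, j == v & i \in white_nbrs G C [set u]].
  by rewrite inE.
have Aiu0 i : i \notin C -> i \notin white_nbrs G C [set u] -> A i u = 0.
  move=> niC; rewrite in_white_nbrs1 niC /= => /A0; apply.
  by apply: contraNneq niC => ->.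
exists u, v, (-1); split=> //; split=> // [p i j|i j nij].
  rewrite cellG' inE => /andP[njiO jip]; rewrite mxE (cA _ _ _ jip).
  case: andP => [[ejv niC]|]; last by rewrite mul0r addr0.
  rewrite Aiu0 ?mulr0 ?addr0 //; apply: contraNN njiO => iN.
  by rewrite opE iN ejv !andbT; apply/edgesP; exists p.
move=> njiE'; rewrite mxE.
have [jiO|njiO] := boolP ((j, i) \in op_edges G C u v).
  move: jiO; rewrite opE => /and3P[_ /eqP-> iN]; have := same _ iN.
  move: (iN); rewrite in_white_nbrs1 => /andP[-> _].
  case/existsP=> p /andP[/cA-> /cA->].
  by rewrite eqxx mul1r mulN1r subrr.
have njiE : (j, i) \notin edges G.
  apply: contraNN njiE' => /edgesP[p jip]; apply/edgesP; exists p.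
  by rewrite cellG' inE jip njiO.
rewrite A0 // add0r; case: andP => [[/eqP ejv niC]|]; last by rewrite mul0r.
rewrite Aiu0 ?mulr0 //; apply: contraNN njiE => /(subsetP sN).
by rewrite in_white_nbrs1 ejv => /andP[].
Qed.

Lemma edge_operations_generates C G G' :
  clos_refl_trans _ (elementary_edge_operation C) G G' ->
  (forall c A, realizes G' c A -> generates A C) ->
  forall c A, realizes G c A -> generates A C.
Proof.
elim=> // {G G'} [G G' op gen c A realA|G1 G2 G3 _ IH1 _ IH2 /IH2/IH1//].
have [u [v [a [uC /gen]]]] : exists u v a,
    u \in C /\ realizes G' c (add_column A C u v a).
  by case: op; [apply: turn_color_realizes | apply: remove_edges_realizes].
exact: generates_add_column.
Qed.

End Realizations.

Lemma colored_class_realizes (R : realType) n k (G : colored_digraph n k)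
    (A : 'M[R]_n) :
  colored_qualitative_class G A -> exists c, realizes G c A.
Proof.
move=> [qual col].
exists (fun r => if [pick e in cell G r] is Some e then A e.2 e.1 else 1).
split=> [r|r i j jir|i j nij njiE].
- case: pickP => [[j i] /= jir|_]; last exact: oner_neq0.
  rewrite qual; first by apply/edgesP; exists r.
  by apply: contraTneq jir => ->; apply: cell_loopless.
- case: pickP => [[l p] /= lpr|/(_ (j, i))]; last by rewrite jir.
  exact: col jir lpr.
by apply/eqP; rewrite -[_ == _]negbK qual.
Qed.

(** * Steering along polynomial trajectories *)

Section PolynomialSteering.
Variables (F : numFieldType) (n m : nat) (A : 'M[F]_n) (B : 'M[F]_(n, m)).

Let Ap := map_mx polyC A.
Let Bp := map_mx polyC B.
Let q : {poly F} := 'X * ('X - 1).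

Definition eval_mx (t : F) p (v : 'cV[{poly F}]_p) := map_mx (horner_eval t) v.

(** The forcing w' - A w that makes the curve [w] a trajectory. *)
Definition defect (w : 'cV[{poly F}]_n) := map_mx (@deriv F) w - Ap *m w.

Lemma defectD w1 w2 : defect (w1 + w2) = defect w1 + defect w2.
Proof.
rewrite /defect mulmxDr opprD addrACA; congr (_ + _).
by apply/matrixP => i j; rewrite !mxE derivD.
Qed.

Lemma defectZ p w : defect (p *: w) = p^`() *: w + p *: defect w.
Proof.
rewrite /defect -scalemxAr scalerBr addrA; congr (_ - _).
by apply/matrixP => i j; rewrite !mxE derivM.
Qed.

Lemma defect_polyC a :
  defect (map_mx polyC a) = - map_mx polyC (A *m a).
Proof.
rewrite /defect map_mxM -[RHS]add0r; congr (_ - _).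
by apply/matrixP => i j; rewrite !mxE derivC.
Qed.

Lemma eval_mxD t p (v w : 'cV[{poly F}]_p) :
  eval_mx t (v + w) = eval_mx t v + eval_mx t w.
Proof. by rewrite /eval_mx map_mxD. Qed.

Lemma eval_mxZ t p f (v : 'cV[{poly F}]_p) :
  eval_mx t (f *: v) = f.[t] *: eval_mx t v.
Proof. by rewrite /eval_mx map_mxZ. Qed.

Lemma eval_mx_polyC t p (v : 'cV[F]_p) : eval_mx t (map_mx polyC v) = v.
Proof. by apply/matrixP => i j; rewrite !mxE /horner_eval hornerC. Qed.

Lemma horner_qX t N : t = 0 \/ t = 1 -> (q ^+ N.+1).[t] = 0.
Proof.
by case=> ->; rewrite exprS !hornerE ?subrr ?mulr0 ?mul0r.
Qed.

Lemma deriv_qX N : (q ^+ N.+1)^`() = q ^+ N * (q^`() *+ N.+1).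
Proof. by rewrite deriv_exp mulrnAr [in RHS]mulrC. Qed.

(** The derivative of [q] is its own inverse modulo [q]: this lets the defect
    of a curve be lifted from q^N to q^(N+1). *)
Lemma deriv_q_sqr : q^`() * q^`() = 1 + 4 * q.
Proof.
rewrite /q derivM derivB derivX derivC; ring.
Qed.

(** Induction on [N]: if the defect of z is q^N b, adding q^(N+1) d to z does
    not move the end points and adds (N+1) q^N q' d to the defect, up to a
    multiple of q^(N+1); as q' is invertible modulo q, some d cancels b
    modulo q. *)
Lemma approximate_trajectory (x0 x1 : 'cV[F]_n) N : exists z b,
  [/\ eval_mx 0 z = x0, eval_mx 1 z = x1 & defect z = q ^+ N *: b].
Proof.
elim: N => [|N [z [b [z0 z1 zb]]]].
  exists (map_mx polyC x0 + 'X *: map_mx polyC (x1 - x0)); eexists; split.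
  - by rewrite eval_mxD eval_mxZ !eval_mx_polyC hornerX scale0r addr0.
  - by rewrite eval_mxD eval_mxZ !eval_mx_polyC hornerX scale1r addrC subrK.
  by rewrite expr0 scale1r.
pose a : {poly F} := (N.+1%:R^-1)%:P.
have aN : a * N.+1%:R = 1.
  by rewrite -polyC_natr -polyCM mulVf ?pnatr_eq0.
(* d solves (N+1) q' d = - b modulo q. *)
pose d := - (a * q^`()) *: b.
exists (z + q ^+ N.+1 *: d), (defect d - 4 *: b); split.
- by rewrite eval_mxD eval_mxZ horner_qX ?scale0r ?addr0 //; left.
- by rewrite eval_mxD eval_mxZ horner_qX ?scale0r ?addr0 //; right.
rewrite defectD zb defectZ deriv_qX [in X in _ + (X + _)]/d.
rewrite addrA [in RHS]scalerBr [RHS]addrC; congr (_ + _).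
rewrite !scalerA -scalerDl -scaleNr; congr (_ *: _).
have -> : q ^+ N * (q^`() *+ N.+1) * - (a * q^`()) =
    - q ^+ N * (a * N.+1%:R) * (q^`() * q^`()).
  by rewrite -mulr_natr; ring.
by rewrite aN deriv_q_sqr exprS; ring.
Qed.

(** A forcing term that some input reproduces while moving the state 0 back to
    itself. *)
Definition correctable (f : 'cV[{poly F}]_n) := exists w u,
  [/\ eval_mx 0 w = 0, eval_mx 1 w = 0 & defect w = Bp *m u + f].

Lemma correctable0 : correctable 0.
Proof.
exists 0, 0; split; rewrite /eval_mx ?map_mx0 //.
by rewrite mulmx0 addr0 -(map_mx0 polyC) defect_polyC mulmx0 !map_mx0 oppr0.
Qed.

Lemma correctableD f g : correctable f -> correctable g -> correctable (f + g).
Proof.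
move=> [w [u [w0 w1 wf]]] [w' [u' [w0' w1' wf']]].
exists (w + w'), (u + u'); split; rewrite ?eval_mxD ?w0 ?w1 ?w0' ?w1' ?addr0 //.
by rewrite defectD wf wf' mulmxDr addrACA.
Qed.

(** Vanishing to some finite order at both end points is required of the
    forcing because each multiplication by [A] costs one derivative of it. *)
Definition flatly_correctable (a : 'cV[F]_n) :=
  exists N, forall p, correctable ((q ^+ N * p) *: map_mx polyC a).

Lemma flatly_correctable_linear : linear_set flatly_correctable.
Proof.
split=> [|a u v [N HN] [M HM]].
  by exists 0%N => p; rewrite map_mx0 scaler0; apply: correctable0.
exists (N + M)%N => p; rewrite map_mxD map_mxZ scalerDr scalerA exprD.
apply: correctableD.
  by have := HN (q ^+ M * p * a%:P); rewrite !mulrA.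
by have := HM (q ^+ N * p); rewrite mulrCA mulrA.
Qed.

Lemma flatly_correctable_col j : flatly_correctable (col j B).
Proof.
exists 0%N => p; exists 0, (- p *: delta_mx j 0).
split; rewrite /eval_mx ?map_mx0 //.
rewrite -(map_mx0 polyC) defect_polyC mulmx0 !map_mx0 oppr0.
rewrite -scalemxAr -colE expr0 mul1r scaleNr map_col addrC.
by apply/esym/eqP; rewrite subr_eq0.
Qed.

(** The curve - f a has defect f A a - f' a, and if f is flat of order N + 1
    then f' is flat of order N, so f' a is already correctable. *)
Lemma flatly_correctable_mul a :
  flatly_correctable a -> flatly_correctable (A *m a).
Proof.
move=> [N HN]; exists N.+1 => p.
have [w [u [w0 w1 wf]]] := HN (q^`() *+ N.+1 * p + q * p^`()).
have qp0 t : t = 0 \/ t = 1 -> (q ^+ N.+1 * p).[t] = 0.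
  by move=> /(horner_qX N) qt0; rewrite hornerM qt0 mul0r.
exists (- (q ^+ N.+1 * p) *: map_mx polyC a + w), u; split.
- by rewrite eval_mxD eval_mxZ w0 hornerN qp0 ?oppr0 ?scale0r ?addr0 //; left.
- by rewrite eval_mxD eval_mxZ w1 hornerN qp0 ?oppr0 ?scale0r ?addr0 //; right.
rewrite defectD defectZ wf defect_polyC scalerN scaleNr opprK derivN derivM.
rewrite deriv_qX exprS scaleNr.
rewrite addrCA; congr (_ + _); rewrite addrAC -scaleNr -scalerDl.
rewrite [X in X *: _ + _](_ : _ = 0); last by ring.
by rewrite scale0r add0r.
Qed.

Lemma correctable_forcing : (forall j, flatly_correctable (delta_mx j 0)) ->
  exists N, forall b, correctable (q ^+ N *: b).
Proof.
move=> /fin_all_exists[Nf HN]; exists (\max_j Nf j)%N => b.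
have -> : b = \sum_j b j 0 *: map_mx polyC (delta_mx j 0).
  rewrite [LHS]matrix_sum_delta; apply: eq_bigr => j _.
  by rewrite big_ord1 map_delta_mx.
rewrite scaler_sumr; apply: (big_ind correctable) => [||j _].
- exact: correctable0.
- exact: correctableD.
rewrite scalerA; have le_j : (Nf j <= \max_j Nf j)%N by apply: leq_bigmax.
by rewrite -(subnKC le_j) exprD -mulrA; apply: HN.
Qed.

Lemma polynomial_steering (x0 x1 : 'cV[F]_n) : kalman_condition A B ->
  exists x u, [/\ eval_mx 0 x = x0, eval_mx 1 x = x1 & defect x = Bp *m u].
Proof.
move=> gen; have [|N HN] := correctable_forcing.
  move=> j; apply: gen; [exact: flatly_correctable_linear | |].
  - exact: flatly_correctable_mul.
  - exact: flatly_correctable_col.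
have [z [b [z0 z1 zb]]] := approximate_trajectory x0 x1 N.
have [w [u [w0 w1 wf]]] := HN (- b).
exists (z + w), u; split; rewrite ?eval_mxD ?z0 ?z1 ?w0 ?w1 ?addr0 //.
by rewrite defectD zb wf scalerN addrC subrK.
Qed.

End PolynomialSteering.

Lemma kalman_controllable (R : realType) n m (A : 'M[R]_n)
    (B : 'M[R]_(n, m)) : kalman_condition A B -> controllable_pair A B.
Proof.
move=> gen x0 x1; have [x [u [x00 x11 xu]]] := polynomial_steering x0 x1 gen.
exists 1, (fun t => eval_mx t u), (fun t => eval_mx t x); split=> //.
- move=> j; have -> : (fun t => eval_mx t u j ord0) = horner (u j 0).
    by apply/boolp.funext => t; rewrite mxE.
  exact: continuous_horner.
move=> t i; have -> : (fun s => eval_mx s x i ord0) = horner (x i 0).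
  by apply/boolp.funext => s; rewrite mxE.
have -> : (A *m eval_mx t x + B *m eval_mx t u) i ord0 = (x i 0)^`().[t].
  have : eval_mx t (map_mx (@deriv R) x) = A *m eval_mx t x + B *m eval_mx t u.
    move/eqP: xu; rewrite /defect subr_eq addrC => /eqP->.
    have evC p l (M : 'M[R]_(p, l)) :
        map_mx (horner_eval t) (map_mx polyC M) = M.
      by apply/matrixP => a b; rewrite !mxE /horner_eval hornerC.
    by rewrite eval_mxD /eval_mx !map_mxM !evC.
  by move/matrixP/(_ i ord0) <-; rewrite !mxE.
exact: is_derive_poly.
Qed.

Theorem corollary20 (R : realType) (n k : nat) (G G' : colored_digraph n k)
    (VL : {set 'I_n})
    (hops : clos_refl_trans (colored_digraph n k)
              (elementary_edge_operation VL) G G')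
    (hzf : zero_forcing_set G' VL) :
  controllable R G VL.
Proof.
move=> A /colored_class_realizes[c realA].
have gen : generates A VL.
  apply: edge_operations_generates hops _ _ _ realA => c' A' realA'.
  exact: zero_forcing_generates realA' hzf.
apply: kalman_controllable => W linW invW WB.
apply: gen => // j jVL.
(* The basis vector of a leader is a column of the leader matrix. *)
have := WB (enum_rank_in jVL j).
congr W; apply/matrixP => i l.
by rewrite !mxE [l]ord1 eqxx andbT enum_rankK_in.
Qed.
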